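(* Let $D$ be a noncommutative division ring (of arbitrary characteristic), and let $n$ be a nonnegative integer. Suppose that $f, g \colon D \to D$ are additive maps satisfying $f(x) = x^n g(x^{-1})$ for all $x \in D^{\times}$. Then the following hold: (i) If $n = 2$, then $f = g$ and $f(x) = x f(1)$ for all $x \in D$; (ii) If $n \neq 2$, then $f = 0$ and $g = 0$.
   Context: Rings are associative with unity. $D^{\times}$ denotes the set of units of $D$, i.e. $D \setminus \{0\}$. A map $f \colon D \to D$ is additive if $f(x+y) = f(x) + f(y)$ for all $x, y \in D$. ''Noncommutative'' means that $D$ is not a field. *)

(* Defs.v *)
From mathcomp Require Import all_boot all_algebra.

Set Implicit Arguments.
Unset Strict Implicit.
Unset Printing Implicit Defensive.

Import GRing.Theory.
Local Open Scope ring_scope.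

(* Despite its name, GRing.field_axiom only says that every nonzero element is
   a unit; over a unitRingType (nontrivial, not assumed commutative) this is
   exactly the notion of a division ring. *)
Definition division_ring (D : unitRingType) : Prop := GRing.field_axiom D.

Definition noncommutative (D : pzRingType) : Prop :=
  ~ (forall x y : D, x * y = y * x).

(* Main.v *)
From HB Require Import structures.
Require Import Defs.
From mathcomp Require Import all_boot all_algebra.
From mathcomp Require Import finfield zify.
From Stdlib Require Import Classical.

Import GRing.Theory.
Local Open Scope ring_scope.

(** Let Z be the centre of D and P(x) = (1 + x)^n - 1 - x^n. Because f and g
    are additive, the relation f(x) = x^n g(x^-1) turns the identity
    (x + xzx)^-1 = x^-1 - (x + z^-1)^-1 into

      f(x^2 z) = P(xz) f(x) - x^n g(z)   for commuting x and z, n > 0,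

    which is [square_mul_identity]. In particular f + g = P f(1), and
    f(x^2) = P(x) f(x) as soon as f(1) = 0. Here f(x^2) is quadratic in x
    while P(x) f(x) has degree at least 3 when some binomial C(n, i) with
    1 < i < n is nonzero in D. Over a commutative field of positive
    characteristic such a coincidence can occur with f <> 0; in a
    noncommutative D it cannot, for two different reasons.

    If Z is finite, then D has elements t of arbitrarily large degree over Z
    ([exists_large_degree]); otherwise all units would have bounded order, and
    Wedderburn's theorem on finite division rings would make D commutative.
    Substituting t x for one variable of a multilinear identity and
    subtracting t times the identity eliminates that variable, so identities of
    the form sum_k x_k F_k = 0, with F_k independent of x_k, force all F_k
    to vanish ([functional_identity]). Applied to the iterated differences of
    x^m e(x), this shows that for an additive e <> 0 the degree of
    x^m e(x) is m + 1 and no less ([degree_ltX_eq0]).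

    If Z is infinite, the identities may be evaluated at x + z^2 y or y z
    for infinitely many central z and compared coefficient by coefficient
    in z. Every case yields an exponent i > 0 such that all x^i are central,
    and this makes D commutative ([all_central_of_pow]).

    When all C(n, i) with 1 < i < n vanish in D, n > 0 and n <> 2, one has P = 0,
    g = -f and 2 f = 0. The same two methods reduce to the case where f
    vanishes on xy + yx, hence is invariant under conjugation; comparing
    f(x) = -x^n f(x^-1) with its conjugates shows that x^n is central
    wherever f(x) <> 0, and both methods apply again ([tracial_eq0]).

    For n = 2, subtracting x f(1) from f and g gives f(1) = 0, and then
    f(x^2) = 2 x f(x). In characteristic 2 this is again the
    conjugation-invariant situation; otherwise f is a left Jordan derivation
    and [[x, y], x] f(x) = 0 forces x to be central wherever f(x) <> 0. For
    n = 0, f(xzx) = -f(x) - g(z), and additivity in z gives f(x) = 0. *)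

(** * Finite subrings of division rings *)

Section Wedderburn.
Set Implicit Arguments.
Unset Strict Implicit.

(** Wedderburn's little theorem for a finite set closed under the operations of
    D: such a set is itself a finite domain. *)
Lemma finite_subring_comm (D : unitRingType) (s : seq D) :
  division_ring D ->
  1 \in s -> {in s &, forall x y, x - y \in s} ->
  {in s &, forall x y, x * y \in s} -> {in s, forall x, x^-1 \in s} ->
  {in s &, forall x y, x * y = y * x}.
Proof.
move=> divD s1 sB sM sV.
have dc : GRing.divring_closed (mem s).
  by split => // x y sx sy; apply: sM => //; apply: sV.
pose R : finUnitRingType :=
  HB.pack (seq_sub s)
    (GRing.SubChoice_isSubUnitRing.Build D (mem s) (seq_sub s) dc).
have vM (u v : R) : ssval (u * v) = ssval u * ssval v by [].
have v0 : ssval (0 : R) = 0 by [].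
have domR : GRing.integral_domain_axiom R.
  move=> u v uv; have uv0 : ssval u * ssval v = 0 by rewrite -vM uv v0.
  have [u0|/divD uu] := eqVneq (ssval u) 0.
    by apply/orP; left; apply/eqP/val_inj.
  apply/orP; right; apply/eqP/val_inj; rewrite /=.
  by apply: (mulrI uu); rewrite uv0 mulr0.
move=> x y sx sy.
have := finDomain_mulrC domR (SeqSub sx) (SeqSub sy).
by move/(congr1 (@ssval _ _)); rewrite !vM.
Qed.

End Wedderburn.

(** * The centre, spans over it, and linear generalized identities *)

Section Span.
Set Implicit Arguments.
Unset Strict Implicit.
Variable D : unitRingType.
Implicit Types (x y z t : D) (l s : seq D).

Definition central z := forall x, z * x = x * z.

Definition finite_pred (Q : D -> Prop) := exists s, forall x, Q x <-> x \in s.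

Lemma sub_finite_pred (Q : D -> Prop) s :
  (forall x, Q x -> x \in s) -> finite_pred Q.
Proof.
elim: s Q => [|a s IH] Q sQ.
  by exists [::] => x; split => // /sQ.
have [x|s' s'P] := IH (fun x => Q x /\ x <> a).
  by case=> /sQ; rewrite inE => /orP[/eqP|].
have [Qa|nQa] := classic (Q a); [exists (a :: s')|exists s'] => x.
  rewrite inE; split.
    case: (eqVneq x a) => //= /eqP xa Qx; exact/s'P.
  by case/orP=> [/eqP->//|/s'P[]].
split; last by case/s'P.
by move=> Qx; apply/s'P; split => // xa; apply: nQa; rewrite -xa.
Qed.

Lemma central0 : central 0. Proof. by move=> x; rewrite mul0r mulr0. Qed.
Lemma central1 : central 1. Proof. by move=> x; rewrite mul1r mulr1. Qed.
Lemma centralN z : central z -> central (- z).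
Proof. by move=> cz x; rewrite mulNr cz mulrN. Qed.
Lemma centralD z z' : central z -> central z' -> central (z + z').
Proof. by move=> cz cz' x; rewrite mulrDl cz cz' mulrDr. Qed.
Lemma centralB z z' : central z -> central z' -> central (z - z').
Proof. by move=> cz cz'; apply/centralD/centralN. Qed.
Lemma centralM z z' : central z -> central z' -> central (z * z').
Proof. by move=> cz cz' x; rewrite -mulrA cz' mulrA cz mulrA. Qed.
Lemma centralX z n : central z -> central (z ^+ n).
Proof.
move=> cz; elim: n => [|n IH]; first exact: central1.
by rewrite exprS; apply: centralM.
Qed.
Lemma central_nat n : central n%:R.
Proof. by move=> x; rewrite mulr_natl mulr_natr. Qed.

Lemma noncentralP x : ~ central x -> exists y, y * x - x * y <> 0.
Proof.
move=> ncx; apply: NNPP => ny; apply: ncx => y; apply: NNPP => xy; apply: ny.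
by exists y => /subr0_eq e; apply: xy.
Qed.

Fixpoint in_span l d : Prop :=
  if l is a :: l' then exists z, central z /\ in_span l' (d - z * a) else d = 0.

Lemma in_span0 l : in_span l 0.
Proof.
elim: l => //= a l IH; exists 0; split; first exact: central0.
by rewrite mul0r subr0.
Qed.

Lemma in_spanD l d e : in_span l d -> in_span l e -> in_span l (d + e).
Proof.
elim: l d e => [|a l IH] d e /=; first by move=> -> ->; rewrite addr0.
case=> z [cz dz] [w [cw ew]]; exists (z + w); split; first exact: centralD.
by rewrite mulrDl opprD addrACA; apply: IH.
Qed.

Lemma in_spanZ l z d : central z -> in_span l d -> in_span l (z * d).
Proof.
move=> cz; elim: l d => [|a l IH] d /=; first by move=> ->; rewrite mulr0.
case=> w [cw dw]; exists (z * w); split; first exact: centralM.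
by rewrite -mulrA -mulrBr; apply: IH.
Qed.

Lemma in_spanN l d : in_span l d -> in_span l (- d).
Proof. by rewrite -mulN1r; apply/in_spanZ/centralN/central1. Qed.

Lemma in_span_cons a l d : in_span l d -> in_span (a :: l) d.
Proof. by exists 0; split; [exact: central0|rewrite mul0r subr0]. Qed.

Lemma in_span_mem l a : a \in l -> in_span l a.
Proof.
elim: l => //= b l IH; rewrite inE => /orP[/eqP->|/IH/(in_span_cons b)//].
by exists 1; split; [exact: central1|rewrite mul1r subrr; exact: in_span0].
Qed.

Lemma in_span_lin l l' (h : D -> D) :
  (forall x y, h (x + y) = h x + h y) ->
  (forall z x, central z -> h (z * x) = z * h x) ->
  {in l, forall a, in_span l' (h a)} ->
  forall d, in_span l d -> in_span l' (h d).
Proof.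
move=> hD hZ; elim: l => [|a l IH] /= la d.
  move=> ->; have -> : h 0 = 0 by apply: (addrI (h 0)); rewrite -hD !addr0.
  exact: in_span0.
case=> z [cz dz]; rewrite -[d](subrK (z * a)) hD; apply: in_spanD.
  by apply: IH dz => b lb; apply: la; rewrite inE lb orbT.
by rewrite hZ //; apply: in_spanZ => //; apply: la; rewrite mem_head.
Qed.

Fixpoint span_list s l : seq D :=
  if l is a :: l' then [seq z * a + r | z <- s, r <- span_list s l'] else [:: 0].

Lemma size_span_list s l : size (span_list s l) = (size s ^ size l)%N.
Proof. by elim: l => //= a l IH; rewrite size_allpairs IH expnS. Qed.

Lemma span_listP s l d :
  (forall z, central z -> z \in s) -> in_span l d -> d \in span_list s l.
Proof.
move=> sZ; elim: l d => [|a l IH] d /=; first by move=> ->; rewrite inE.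
case=> z [cz dz]; apply/allpairsP; exists (z, d - z * a) => /=.
by split; [exact: sZ|exact: IH|rewrite addrC subrK].
Qed.

Hypothesis divD : division_ring D.

Lemma unit_of_neq0 x : x <> 0 -> x \is a GRing.unit.
Proof. by move/eqP/divD. Qed.

Lemma div_neq0 x y : x != 0 -> y != 0 -> x * y != 0.
Proof. by move=> /divD ux; rewrite -{2}(mulr0 x) (inj_eq (mulrI ux)). Qed.

Lemma div_mulf_eq0 x y : x * y = 0 -> x <> 0 -> y = 0.
Proof. by move=> xy0 /eqP/divD ux; rewrite -[y](mulKr ux) xy0 mulr0. Qed.

Lemma div_mulf_eq0r x y : x * y = 0 -> y <> 0 -> x = 0.
Proof. by move=> xy0 /eqP/divD uy; rewrite -[x](mulrK uy) xy0 mul0r. Qed.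

Lemma centralV z : z != 0 -> central z -> central z^-1.
Proof.
move=> /divD uz cz x; apply: (mulrI uz); rewrite mulVKr // mulrA cz -mulrA.
by rewrite divrr // mulr1.
Qed.

(** This is where the centre enters: the maps x |-> a x b behave like pure
    tensors over Z, so a relation d x F + sum_p a_p x b_p = 0 with F <> 0
    makes d dependent on the a_p over Z. *)
Lemma in_span_of_linear_identity (L : seq (D * D)) d F :
  (forall x, d * x * F + \sum_(p <- L) p.1 * x * p.2 = 0) -> F <> 0 ->
  in_span (map fst L) d.
Proof.
move En: (size L) => n; elim: n L En d F => [|n IH] [|[a G] L] //= En d F LI F0.
  have := LI 1; rewrite big_nil addr0 mulr1 => /div_mulf_eq0r; exact.
have {En}En : size L = n by case: En.
have [G0|/divD uG] := eqVneq G 0.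
  apply: (@in_span_cons a); apply: IH F0 => // x; have := LI x.
  by rewrite big_cons /= G0 mulr0 add0r.
(* Make the last right factor equal to 1. *)
have {}LI x : d * x * (F / G) + (a * x + \sum_(p <- L) p.1 * x * (p.2 / G)) = 0.
  have := congr1 (fun u => u / G) (LI x).
  rewrite big_cons /= mul0r 2!mulrDl -mulrA -(mulrA _ G) divrr // mulr1.
  rewrite mulr_suml => e; rewrite -[RHS]e; congr (_ + (_ + _)).
  by apply: eq_bigr => p _; rewrite mulrA.
have F1 : F / G <> 0.
  by move/(congr1 ( *%R^~ G)); rewrite /= divrK // mul0r.
move: (F / G) F1 LI => {F0}; clear F => F F0 LI.
have uF : F \in GRing.unit by apply/divD/eqP.
have [cF|ncF] := classic (central F).
  suff H : in_span (map fst L) (F * d + a).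
    exists (- F^-1); split; first by apply/centralN/centralV => //; apply/eqP.
    rewrite mulNr opprK -[d](mulKr uF) -mulrDr; apply: in_spanZ => //.
    by apply: centralV => //; apply/eqP.
  have := IH [seq (p.1, p.2 / G) | p <- L] _ (F * d + a) 1.
  rewrite size_map -map_comp; apply => [//|x|/eqP]; last by rewrite oner_eq0.
  rewrite mulr1 big_map /= -[RHS](LI x) addrA; congr (_ + _).
  by rewrite mulrDl -mulrA cF.
(* Substituting x w for x and subtracting the identity times w removes the
   term of a and keeps that of d, as F does not commute with w. *)
have [w Fw] := noncentralP ncF.
apply: (@in_span_cons a).
have := IH [seq (p.1, w * (p.2 / G) - (p.2 / G) * w) | p <- L] _ d (w * F - F * w).
rewrite size_map -map_comp; apply => // x.
transitivity ((d * (x * w) * F + (a * (x * w)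
             + \sum_(p <- L) p.1 * (x * w) * (p.2 / G)))
    - (d * x * F + (a * x + \sum_(p <- L) p.1 * x * (p.2 / G))) * w); last
  by rewrite !LI mul0r subrr.
rewrite !mulrDl !opprD addrACA [X in _ = _ + X]addrACA (mulrA a) subrr add0r.
rewrite mulr_suml -sumrB big_map /= mulrBr !mulrA; congr (_ + _).
by apply: eq_bigr => p _; rewrite mulrBr !mulrA.
Qed.
End Span.

(** * Elements of large degree over a finite centre *)

Section Exponent.
Set Implicit Arguments.
Unset Strict Implicit.
Variables (D : unitRingType) (divD : division_ring D).
Implicit Types (x y z t w : D) (l s : seq D).

Lemma horner_XsubC_mul (q : {poly D}) a x :
  (('X - a%:P) * q).[x] = q.[x] * x - a * q.[x].
Proof. by rewrite mulrBl hornerD hornerN hornerCM -commr_polyX hornerMX. Qed.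

(** Evaluation at x, with coefficients kept on the left, turns multiplication
    by X - a into the map v |-> v x - a v. When a product of such maps kills a
    nonzero element, one of the factors kills some nonzero w. *)
Lemma eigenvector_of_prod (rs : seq D) (q : {poly D}) x :
  ((\prod_(a <- rs) ('X - a%:P)) * q).[x] = 0 -> q.[x] <> 0 ->
  exists a w, [/\ a \in rs, w <> 0 & w * x = a * w].
Proof.
elim: rs => [|a rs IH]; first by rewrite big_nil mul1r.
rewrite big_cons -mulrA horner_XsubC_mul => /subr0_eq e q0.
have [e0|] := classic (((\prod_(a <- rs) ('X - a%:P)) * q).[x] = 0).
  have [b [w [rb w0 wx]]] := IH e0 q0.
  by exists b, w; split; rewrite ?inE ?rb ?orbT.
by exists a, ((\prod_(a <- rs) ('X - a%:P)) * q).[x]; rewrite mem_head.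
Qed.

Lemma uniq_roots_comm rs : {in rs &, forall a b : D, a * b = b * a} -> uniq rs ->
  uniq_roots rs.
Proof.
elim: rs => //= a rs IH cab /andP[nars urs]; apply/andP; split; last first.
  by apply: IH => // b c rb rc; apply: cab; rewrite inE ?rb ?rc orbT.
apply/allP => b rb; rewrite /diff_roots cab ?inE ?eqxx ?rb ?orbT //=.
by apply: divD; rewrite subr_eq0; apply: contraNneq nars => <-.
Qed.

(** An element of finite order o satisfies X^o - 1 = prod_i (X - x^i), all
    factors commuting. Applied to y, this product gives y x^o - y = 0 while the
    factor X - x alone gives y x - x y <> 0; hence some other factor X - x^i
    has an eigenvector w, that is, conjugation by w maps x to another power
    of x. *)
Lemma finite_order_normalizes x M : (0 < M)%N -> x <> 0 -> x ^+ M = 1 ->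
  ~ central x ->
  exists i w, [/\ w <> 0, w * x = x ^+ i * w & x ^+ i <> x].
Proof.
move=> M0 x0 xM ncx.
have [o /andP[o0 /eqP xo] omin] : exists2 o, (0 < o)%N && (x ^+ o == 1) &
    forall i, (0 < i)%N && (x ^+ i == 1) -> (o <= i)%N.
  have ex : exists o, (0 < o)%N && (x ^+ o == 1) by exists M; rewrite M0 xM eqxx.
  by exists (ex_minn ex); case: ex_minnP.
have ux : x \in GRing.unit by apply/divD/eqP.
have [y xy] := noncentralP ncx.
(* The root x comes last, so that X - x is the first factor to act on y;
   the root 1 appears as x ^+ o. *)
pose rs := [seq x ^+ i | i <- iota 2 o.-1].
have uidx (i j : nat) : (0 < i <= o)%N -> (0 < j <= o)%N -> x ^+ i = x ^+ j -> i = j.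
  wlog ij : i j / (i <= j)%N.
    by move=> H hi hj e; case/orP: (leq_total i j) => ij; [|symmetry]; apply: H.
  move=> /andP[i0 io] /andP[j0 jo] e; apply/eqP; rewrite eqn_leq ij /= leqNgt.
  apply/negP => ltij; have : (o <= j - i)%N; last by lia.
  apply: omin; rewrite subn_gt0 ltij /=; apply/eqP.
  by apply: (mulrI (unitrX i ux)); rewrite -exprD subnKC // mulr1.
have rsx : rs ++ [:: x] = [seq x ^+ i | i <- iota 2 o.-1 ++ [:: 1%N]].
  by rewrite map_cat /= expr1.
have Xo : 'X^o - 1 = \prod_(a <- rs ++ [:: x]) ('X - a%:P) :> {poly D}.
  have mo : 'X^o - 1 \is @monic D by rewrite monicXnsubC.
  rewrite [LHS](@all_roots_prod_XsubC _ _ (rs ++ [:: x])).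
  - by rewrite (monicP mo) scale1r.
  - by rewrite size_XnsubC // size_cat size_map size_iota addn1 prednK.
  - rewrite rsx; apply/allP => _ /mapP[i _ ->].
    rewrite rootE hornerD hornerN hornerXn hornerC -exprM mulnC exprM xo.
    by rewrite expr1n subrr.
  apply: uniq_roots_comm.
    by rewrite rsx => _ _ /mapP[i _ ->] /mapP[j _ ->]; rewrite -!exprD addnC.
  rewrite rsx map_inj_in_uniq ?cat_uniq ?iota_uniq /= ?mem_iota //.
  move=> i j; rewrite !mem_cat !mem_iota !inE => hi hj; apply: uidx; lia.
have := @eigenvector_of_prod rs (('X - x%:P) * y%:P) x.
rewrite horner_XsubC_mul hornerC => /(_ _ xy) [].
  rewrite mulrA -[X in _ * X * _](big_seq1 *%R x (fun a => 'X - a%:P)).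
  rewrite -big_cat -Xo mulrBl mul1r -commr_polyXn.
  by rewrite hornerD hornerN hornerCM hornerXn hornerC xo mulr1 subrr.
move=> _ [w [/mapP[i hi ->] w0 wx]]; exists i, w; split => //.
move=> e; have : i = 1%N; last by move: hi; rewrite mem_iota => hi; lia.
by move: hi; rewrite mem_iota => hi; apply: uidx; rewrite ?expr1 //; lia.
Qed.

(** With x and w as in [finite_order_normalizes], the products x^a w^b form a
    finite set closed under multiplication. Its span over the finite centre
    is a finite division ring in which x and w do not commute, against
    Wedderburn's theorem. *)
Lemma all_central_of_exponent M : finite_pred (@central D) -> (0 < M)%N ->
  (forall x, x <> 0 -> x ^+ M = 1) -> forall x, central x.
Proof.
move=> [sZ sZP] M0 DM x; apply: NNPP => ncx.
have x0 : x <> 0 by move=> x0; apply: ncx; rewrite x0; apply: central0.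
have [e [w [w0 wx xe]]] := finite_order_normalizes M0 x0 (DM _ x0) ncx.
pose G := [seq x ^+ a * w ^+ b | a <- iota 0 M, b <- iota 0 M].
have modM y i : y <> 0 -> y ^+ i = y ^+ (i %% M).
  move=> y0; rewrite {1}(divn_eq i M) exprD mulnC exprM DM // expr1n.
  by rewrite mul1r.
have memG a b : x ^+ a * w ^+ b \in G.
  rewrite modM // (modM w) //; apply: allpairs_f;
  by rewrite mem_iota ltn_mod.
have wXx j k : w ^+ j * x ^+ k = x ^+ (k * e ^ j) * w ^+ j.
  have w1 k' : w * x ^+ k' = x ^+ (k' * e) * w.
    elim: k' => [|k' IH]; first by rewrite mulr1 mul1r.
    by rewrite exprSr mulrA IH -mulrA wx mulrA -exprD mulSn addnC.
  elim: j => [|j IH]; first by rewrite muln1 mulr1 mul1r.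
  by rewrite exprS -mulrA IH mulrA w1 -mulrA expnSr mulnA.
have mulG g h : g \in G -> h \in G -> g * h \in G.
  move=> /allpairsP[[a b] [_ _ ->]] /allpairsP[[a' b'] [_ _ ->]] /=.
  rewrite mulrA -[_ * _ * x ^+ a']mulrA wXx mulrA -exprD -mulrA -exprD.
  exact: memG.
have mulS g h : in_span G g -> in_span G h -> in_span G (g * h).
  move=> Gg Gh.
  apply: (@in_span_lin _ G G ( *%R^~ h)) Gg => [u v|z u _|u Gu].
  - exact: mulrDl.
  - by rewrite mulrA.
  apply: (@in_span_lin _ G G ( *%R u)) Gh => [v v'|z v cz|v Gv].
  - exact: mulrDr.
  - by rewrite mulrA -cz mulrA.
  exact/in_span_mem/mulG.
have [s sP] : finite_pred (in_span G).
  apply: (@sub_finite_pred _ _ (span_list sZ G)) => y; apply: span_listP => z.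
  by move/sZP.
have G1 : in_span G 1.
  by apply: in_span_mem; have := memG 0%N 0%N; rewrite mul1r.
have xw : x * w = w * x.
  apply: (@finite_subring_comm D s divD); try apply/sP.
  - exact: G1.
  - by move=> u v /sP Gu /sP Gv; apply/sP/in_spanD/in_spanN.
  - by move=> u v /sP Gu /sP Gv; apply/sP/mulS.
  - move=> u /sP Gu; have [->|/eqP u0] := eqVneq u 0.
      by rewrite invr0; apply/sP; apply: in_span0.
    suff -> : u^-1 = u ^+ M.-1.
      apply/sP; elim: M.-1 => [|k IH]; first exact: G1.
      by rewrite exprS; apply: mulS.
    have /divD uu : u != 0 by apply/eqP.
    by apply: (mulrI uu); rewrite divrr // -exprS prednK // DM.
  - by apply: in_span_mem; have := memG 1%N 0%N; rewrite mulr1.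
  - by apply: in_span_mem; have := memG 0%N 1%N; rewrite mul1r.
apply: xe; have /divD uw : w != 0 by apply/eqP.
by apply: (mulIr uw); rewrite -wx xw.
Qed.

(** Pigeonhole principle. *)
Lemma torsion_of_finite_powers t (E : seq D) : t <> 0 ->
  (forall i, t ^+ i \in E) -> exists2 i, (0 < i <= size E)%N & t ^+ i = 1.
Proof.
move=> t0 tE; have ut : t \is a GRing.unit by apply/divD/eqP.
have : ~~ uniq [seq t ^+ i | i <- iota 0 (size E).+1].
  apply/negP => /uniq_leq_size H; suff : ((size E).+1 <= size E)%N by lia.
  rewrite -[X in (X <= _)%N](size_iota 0) -(size_map (fun i => t ^+ i)).
  by apply: H => _ /mapP[i _ ->].
move=> nu; apply: NNPP => nt; case/negP: nu.
rewrite map_inj_in_uniq ?iota_uniq // => a b.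
rewrite !mem_iota /= add0n !ltnS => aB bB tab.
wlog ab : a b aB bB tab / (a <= b)%N.
  by move=> H; case/orP: (leq_total a b) => h; [|symmetry]; apply: H.
apply/eqP; rewrite eqn_leq ab leqNgt; apply/negP => ltab.
apply: nt; exists (b - a)%N; first by lia.
by apply: (mulrI (unitrX a ut)); rewrite -exprD subnKC // mulr1.
Qed.

Lemma central_exponent : finite_pred (@central D) ->
  exists2 M, (0 < M)%N & forall z, central z -> z <> 0 -> z ^+ M = 1.
Proof.
move=> [s sP]; exists (size s)`!; first exact: fact_gt0.
move=> z cz z0; have [i|i /dvdn_fact/dvdnP[k ->] zi] := torsion_of_finite_powers (E := s) z0.
  by apply/sP/centralX.
by rewrite mulnC exprM zi expr1n.
Qed.

Lemma exists_large_order : finite_pred (@central D) -> noncommutative D ->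
  forall N, exists2 t : D, t <> 0 & forall i, (0 < i <= N)%N -> t ^+ i <> 1.
Proof.
move=> finZ ncD N; apply: NNPP => nt; apply: ncD.
apply: (@all_central_of_exponent N`!) (fact_gt0 N) _ => // x x0; apply: NNPP => xN.
apply: nt; exists x => // i hi xi; apply: xN.
have /dvdnP[k ->] : (i %| N`!)%N by apply: dvdn_fact.
by rewrite mulnC exprM xi expr1n.
Qed.

Definition low_powers t j := [seq t ^+ i | i <- iota 0 j].

(** If t^j depends on lower powers, then all powers of t lie in a span of at
    most |Z|^j elements, which bounds the order of t; but orders are
    unbounded. *)
Lemma exists_large_degree : finite_pred (@central D) -> noncommutative D ->
  forall m, exists t : D, forall j, (j <= m)%N -> ~ in_span (low_powers t j) (t ^+ j).
Proof.
move=> finZ ncD m; have [sZ sZP] := finZ.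
(* a bound, uniform in j <= m, for the size of the span of low_powers t j *)
pose B := (size sZ ^ m)%N.
have [t t0 tB] := exists_large_order finZ ncD B.
exists t => j jm tj.
have pow i : in_span (low_powers t j) (t ^+ i).
  have memj k : (k <= j)%N -> in_span (low_powers t j) (t ^+ k).
    rewrite leq_eqVlt => /orP[/eqP->//|kj]; apply: in_span_mem.
    by apply: map_f; rewrite mem_iota.
  elim: i => [|i IH]; first exact: memj.
  rewrite exprS; apply: (@in_span_lin _ (low_powers t j) _ ( *%R t)) IH.
  - exact: mulrDr.
  - by move=> z u cz; rewrite mulrA -(cz t) mulrA.
  move=> a /mapP[k]; rewrite mem_iota => /= kj ->.
  by rewrite -exprS; apply: memj.
have sz0 : (0 < size sZ)%N.
  by have /sZP := central0 (D := D); case: (sZ).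
pose E := span_list sZ (low_powers t j).
have szE : (size E <= B)%N.
  by rewrite size_span_list size_map size_iota leq_pexp2l.
have [|i /andP[i0 iE]] := @torsion_of_finite_powers t E t0.
  by move=> i; apply: span_listP (pow i) => z /sZP.
by apply: tB; rewrite i0 (leq_trans iE szE).
Qed.
End Exponent.

(** * Functional identities with one distinguished variable per term *)

Section FunctionalIdentity.
Set Implicit Arguments.
Unset Strict Implicit.
Variables (D : unitRingType) (divD : division_ring D) (t : D) (m : nat).
Hypothesis tdeg :
  forall j, (j <= m)%N -> ~ in_span (low_powers t j) (t ^+ j).
Implicit Types (x y : nat -> D) (I : seq nat).

(** The powers of t used here are independent over Z, so
    [in_span_of_linear_identity] kills the coefficients from the top down. *)
Lemma power_coefs_eq0 N (F : nat -> D) : (N <= m.+1)%N ->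
  (forall z, \sum_(j < N) t ^+ j * z * F j = 0) -> forall j, (j < N)%N -> F j = 0.
Proof.
elim: N => // N IH Nm FN.
have FN0 : F N = 0.
  apply: NNPP => FN0; apply: (tdeg Nm).
  have := @in_span_of_linear_identity _ divD
            [seq (t ^+ i, F i) | i <- iota 0 N] (t ^+ N) (F N) _ FN0.
  rewrite -map_comp; apply => z; rewrite -[RHS](FN z) big_ord_recr addrC /=.
  by rewrite big_map /= -{1}(subn0 N) big_mkord.
move=> j; rewrite ltnS leq_eqVlt => /orP[/eqP->//|].
apply: IH => [|z]; first exact: ltnW.
by have := FN z; rewrite big_ord_recr /= FN0 mulr0 addr0.
Qed.

Definition update x a v : nat -> D := fun i => if i == a then v else x i.
Definition agree_off k x y := forall i, i != k -> x i = y i.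

(** Powers of t commute with t, so subtracting t times the identity from the
    identity with t x_a in place of x_a removes the terms with k = a and
    raises the number N of powers of t by one. This is why the powers of t up
    to t^(N + |I| - 2) must be independent. *)
Lemma functional_identity I N (F : nat -> nat -> (nat -> D) -> D) :
  uniq I -> (N + size I <= m.+2)%N ->
  (forall k j x y, k \in I -> agree_off k x y -> F k j x = F k j y) ->
  (forall x, \sum_(k <- I) \sum_(j < N) t ^+ j * x k * F k j x = 0) ->
  forall k j x, k \in I -> (j < N)%N -> F k j x = 0.
Proof.
elim: I N F => // a I IH N F /= /andP[aI uI] Nm indF FI.
have indFa j x v : F a j (update x a v) = F a j x.
  by apply: indF => [|i /negPf ia]; rewrite ?mem_head // /update ia.
have updI k x v : k \in I -> update x a v k = x k.
  by rewrite /update; case: eqP => // ->; rewrite (negPf aI).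
(* coefficients of the identity at t x_a minus t times the identity at x_a *)
pose G k j x := (if (j < N)%N then F k j (update x a (t * x a)) else 0)
                - (if j is j'.+1 then F k j' x else 0).
have G0 k j x : k \in I -> (j < N.+1)%N -> G k j x = 0.
  apply: IH => //; first by lia.
    move=> {}k {}j {}x y kI xy; have kaI : k \in a :: I by rewrite inE kI orbT.
    have xya : x a = y a by apply: xy; apply: contraNneq aI => ->.
    rewrite /G; congr (_ - _); last by case: (j) => // j'; apply: indF.
    case: ifP => // _; apply: indF => // i ik; rewrite /update xya.
    by case: ifP => // _; apply: xy.
  move=> {j k}{}x.
  pose x' := update x a (t * x a).
  transitivity ((\sum_(k <- a :: I) \sum_(j < N) t ^+ j * x' k * F k j x')
      - t * (\sum_(k <- a :: I) \sum_(j < N) t ^+ j * x k * F k j x)).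
    rewrite !big_cons mulrDr opprD addrACA [X in _ = X + _](_ : _ = 0).
      rewrite add0r mulr_sumr -sumrB; apply: eq_big_seq => k kI.
      rewrite /G /x' updI // (eq_bigr (fun j : 'I_N.+1 =>
        (if (j < N)%N then t ^+ j * x k * F k j x' else 0)
        - (if nat_of_ord j is j'.+1 then t ^+ j * x k * F k j' x else 0))).
        rewrite sumrB; congr (_ - _).
          rewrite big_ord_recr /= ltnn addr0; apply: eq_bigr => j _.
          by rewrite ltn_ord.
        rewrite big_ord_recl add0r mulr_sumr; apply: eq_bigr => j _ /=.
        by rewrite !mulrA -exprS.
      move=> j _; rewrite mulrBr; congr (_ - _).
        by case: ifP => // _; rewrite mulr0.
      by case: (nat_of_ord j) => [|j'] //; rewrite mulr0.
    rewrite mulr_sumr -sumrB big1 // => j _.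
    by rewrite /x' indFa /update eqxx !mulrA -exprSr -exprS subrr.
  by rewrite !FI mulr0 subrr.
(* G k j.+1 = 0 expresses F k j through F k j.+1, and F k N counts as 0 *)
have FI0 d k j x : k \in I -> (j + d.+1 = N)%N -> F k j x = 0.
  elim: d j x => [|d IHd] j x kI jd.
    have := @G0 k j.+1 x kI; rewrite /G ifF ?sub0r; last by lia.
    by move=> e; apply: oppr_inj; rewrite e ?oppr0 //; lia.
  have := @G0 k j.+1 x kI; rewrite /G ifT; last by lia.
  rewrite IHd //; last by lia.
  by rewrite sub0r => e; apply: oppr_inj; rewrite e ?oppr0 //; lia.
move=> k j x; rewrite inE => /orP[/eqP->|kI] jN; last first.
  by apply: (FI0 (N - j.+1)%N) => //; lia.
apply: (@power_coefs_eq0 N (fun j => F a j x)) jN; first by lia.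
move=> z; rewrite -[RHS](FI (update x a z)) big_cons [X in _ = _ + X]big_seq.
rewrite [X in _ = _ + X]big1 ?addr0.
  by apply: eq_bigr => i _; rewrite indFa /update eqxx.
move=> i iI; apply: big1 => l _; rewrite (FI0 (N - l.+1)%N) ?mulr0 //.
by have := ltn_ord l; lia.
Qed.

End FunctionalIdentity.

(** * Iterated differences and the degree of x^m e(x) *)

Section Differences.
Set Implicit Arguments.
Unset Strict Implicit.
Variables (D : unitRingType).
Implicit Types (x y : nat -> D) (I : seq nat) (Phi Psi : D -> D) (e : {additive D -> D}).

(** Iterated difference in the directions [x i] for [i] in [I]. Directions are
    indexed by natural numbers so that the value can serve as one of the
    coefficients of [functional_identity]. *)
Definition diffs x I Phi : D -> D :=
  foldr (fun i Psi z => Psi (z + x i) - Psi z) Phi I.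

Definition degree_lt k Phi :=
  forall x I z, uniq I -> size I = k -> diffs x I Phi z = 0.

Lemma eq_diffs x I Phi Psi : Phi =1 Psi -> diffs x I Phi =1 diffs x I Psi.
Proof. by move=> e; elim: I => //= i I IH z; rewrite !IH. Qed.

Lemma eq_diffs_in x y I Phi :
  {in I, x =1 y} -> diffs x I Phi =1 diffs y I Phi.
Proof.
elim: I => //= i I IH xy z; rewrite !IH ?xy ?mem_head // => j jI;
by apply: xy; rewrite inE jI orbT.
Qed.

Lemma diffsD x I Phi Psi z :
  diffs x I (fun u => Phi u + Psi u) z = diffs x I Phi z + diffs x I Psi z.
Proof. by elim: I z => //= i I IH z; rewrite !IH opprD addrACA. Qed.

Lemma diffsZ x I Phi c z :
  diffs x I (fun u => c * Phi u) z = c * diffs x I Phi z.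
Proof. by elim: I z => //= i I IH z; rewrite !IH mulrBr. Qed.

Lemma diffs_additive x I Phi e z :
  diffs x I (fun u => e (Phi u)) z = e (diffs x I Phi z).
Proof. by elim: I z => //= i I IH z; rewrite !IH raddfB. Qed.

(** Leibniz rule: the second term comes from differencing the left factor,
    which is linear. *)
Lemma diffsM x I Phi z : uniq I ->
  diffs x I (fun u => u * Phi u) z =
  z * diffs x I Phi z + \sum_(k <- I) x k * diffs x (rem k I) Phi (z + x k).
Proof.
elim: I z => [|a I IH] z /=; first by rewrite big_nil addr0.
case/andP=> aI uI; rewrite !IH // big_cons eqxx.
have arr (p q r s u v : D) : s - u = v -> p + q + s - (r + u) = p - r + (q + v).
  by move=> <-; rewrite opprD addrACA [p + q - r]addrAC -addrA.
rewrite mulrDl mulrBr; apply: arr; rewrite -sumrB.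
apply: eq_big_seq => k kI; rewrite eq_sym ifN /=; last first.
  by apply: contraNneq aI => <-.
by rewrite -mulrBr addrAC.
Qed.

Lemma degree_lt_additive e : degree_lt 2 e.
Proof.
move=> x [|a [|b [|//]]] //= z _ _.
have E u v : e (u + v) - e u = e v by rewrite raddfD addrC addKr.
by rewrite !E subrr.
Qed.

Lemma degree_ltS k Phi : degree_lt k Phi -> degree_lt k.+1 Phi.
Proof.
by move=> h x [|a I] //= z /andP[_ uI] [sI]; rewrite !h // subrr.
Qed.

Lemma degree_lt_leq k l Phi : (k <= l)%N -> degree_lt k Phi -> degree_lt l Phi.
Proof.
move=> /subnK <- h; elim: (l - k)%N => // d IH.
by rewrite addSn; apply: degree_ltS.
Qed.

Lemma eq_degree_lt k Phi Psi : Phi =1 Psi -> degree_lt k Phi -> degree_lt k Psi.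
Proof. by move=> e h x I z uI sI; rewrite -(eq_diffs _ _ e) h. Qed.

Lemma degree_ltD k Phi Psi : degree_lt k Phi -> degree_lt k Psi ->
  degree_lt k (fun u => Phi u + Psi u).
Proof. by move=> h h' x I z uI sI; rewrite diffsD h // h' // addr0. Qed.

Lemma degree_ltZ k c Phi : degree_lt k Phi -> degree_lt k (fun u => c * Phi u).
Proof. by move=> h x I z uI sI; rewrite diffsZ h // mulr0. Qed.

Lemma degree_lt_sum k N (Phi : nat -> D -> D) :
  (forall i, (i < N)%N -> degree_lt k (Phi i)) ->
  degree_lt k (fun u => \sum_(i < N) Phi i u).
Proof.
elim: N => [|N IH] h.
  move=> x I z _ _; rewrite (@eq_diffs _ _ _ (fun u => 0 * 0)) => [|u].
    by rewrite (diffsZ x I (fun=> 0)) mul0r.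
  by rewrite big_ord0 mul0r.
apply: (@eq_degree_lt _ (fun u => \sum_(i < N) Phi i u + Phi N u)).
  by move=> u; rewrite big_ord_recr.
by apply: degree_ltD; [apply: IH => i iN; apply/h/ltnW|apply: h].
Qed.

Lemma exists_fresh I : exists a, a \notin I.
Proof.
exists (\max_(i <- I) i).+1; apply/negP => aI.
by have := leq_bigmax_seq (P := predT) (F := id) _ aI isT; rewrite ltnn.
Qed.

(** One more difference, in a fresh direction z - z', vanishes. *)
Lemma diffs_const k Phi x I z z' : degree_lt k.+1 Phi -> uniq I -> size I = k ->
  diffs x I Phi z = diffs x I Phi z'.
Proof.
move=> h uI sI; have [a aI] := exists_fresh I.
pose y i := if i == a then z - z' else x i.
have xy : {in I, x =1 y}.
  by move=> i iI; rewrite /y; case: eqP => // ia; rewrite -ia iI in aI.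
have := h y (a :: I) z'; rewrite /= aI sI => /(_ uI erefl) /subr0_eq.
by rewrite /y eqxx addrCA subrr addr0 -/y -!(eq_diffs_in _ xy).
Qed.

Lemma degree_ltM k Phi : degree_lt k Phi -> degree_lt k.+1 (fun u => u * Phi u).
Proof.
move=> h x I z uI sI; rewrite diffsM // (degree_ltS h) // mulr0 add0r.
rewrite big_seq big1 // => i iI.
by rewrite h ?mulr0 ?rem_uniq // size_rem // sI.
Qed.

Lemma degree_ltX m e : degree_lt m.+2 (fun u => u ^+ m * e u).
Proof.
elim: m => [|m IH].
  by apply: eq_degree_lt (degree_lt_additive e) => u; rewrite mul1r.
by apply: eq_degree_lt (degree_ltM IH) => u; rewrite mulrA -exprS.
Qed.

Lemma degree_lt_square e : degree_lt 3 (fun u => e (u * u)).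
Proof.
move=> x I z uI sI; rewrite diffs_additive.
rewrite (@eq_diffs _ _ _ (fun u => u ^+ 1 * (idfun : {additive D -> D}) u)) //.
by rewrite (@degree_ltX 1) // raddf0.
Qed.

Hypotheses (divD : division_ring D) (finZ : finite_pred (@central D)).
Hypothesis ncD : noncommutative D.

(** Differencing x^(m+1) e(x) in m + 2 directions gives, by the Leibniz rule,
    sum_k x_k F_k where F_k is the difference of x^m e(x) in the other
    directions. If this vanishes identically then so do the F_k, and m drops
    by one. *)
Lemma degree_ltX_eq0 m e : degree_lt m.+1 (fun u => u ^+ m * e u) ->
  forall u, e u = 0.
Proof.
elim: m => [|m IH] h.
  move=> u; have := h (fun=> u) [:: 0%N] 0 isT erefl.
  by rewrite /= !mul1r add0r raddf0 subr0.
apply: IH => x I z uI sI; have [t tdeg] := exists_large_degree divD finZ ncD m.+1.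
have [a aI] := exists_fresh I.
pose F k (j : nat) y := diffs y (rem k (a :: I)) (fun u => u ^+ m * e u) 0.
have uaI : uniq (a :: I) by rewrite /= aI.
have dm := @degree_ltX m e.
rewrite (diffs_const _ _ 0 dm) // -[LHS](_ : F a 0%N x = _); last first.
  by rewrite /F /= eqxx.
apply: (functional_identity divD tdeg (I := a :: I) (N := 1)) => //=.
- by rewrite sI; lia.
- move=> k j y y' kaI yy'; apply: eq_diffs_in => i.
  by rewrite mem_rem_uniq // => /andP[/yy'].
- move=> y; rewrite -[RHS](h y (a :: I) 0 uaI) ?[size _]/= ?sI //.
  rewrite (@eq_diffs y (a :: I) _ (fun u => u * (u ^+ m * e u))) => [|u].
    rewrite diffsM // mul0r add0r; apply: eq_big_seq => k kaI.
    rewrite big_ord1 mul1r; congr (_ * _); apply: (diffs_const _ _ _ dm).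
      exact: rem_uniq.
    by rewrite size_rem //= sI.
  by rewrite mulrA -exprS.
exact: mem_head.
Qed.

Lemma leading_eq0 m (c : nat -> nat) e :
  degree_lt m.+1 (fun u => \sum_(i < m.+1) (c i)%:R * (u ^+ i * e u)) ->
  (c m)%:R <> 0 :> D -> forall u, e u = 0.
Proof.
move=> h /eqP/divD uc; apply: (@degree_ltX_eq0 m e).
pose L u := \sum_(i < m) (- (c i)%:R) * (u ^+ i * e u).
pose T u := \sum_(i < m.+1) (c i)%:R * (u ^+ i * e u).
apply: (@eq_degree_lt _ (fun u => (c m)%:R^-1 * (T u + L u))) => [u|].
  rewrite /T /L big_ord_recr /= addrAC -big_split /= big1 => [|i _].
    by rewrite add0r mulKr.
  by rewrite mulNr subrr.
apply: degree_ltZ; apply: degree_ltD => //.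
apply: (degree_lt_sum (Phi := fun i u => - (c i)%:R * (u ^+ i * e u))) => i im.
by apply: degree_ltZ; apply: degree_lt_leq (@degree_ltX i e); lia.
Qed.
End Differences.

(** * Comparing coefficients over an infinite centre *)

Section InfiniteCentre.
Set Implicit Arguments.
Unset Strict Implicit.
Variables (D : unitRingType) (divD : division_ring D).
Implicit Types (x y a u v : D).

(** Binomial theorem when all inner coefficients vanish, as for a power of the
    characteristic. *)
Lemma exprD_of_bin0 (R : nzRingType) (a b : R) i : (0 < i)%N -> GRing.comm a b ->
  (forall j, (0 < j < i)%N -> 'C(i, j)%:R = 0 :> R) ->
  (a + b) ^+ i = a ^+ i + b ^+ i.
Proof.
case: i => // i _ cab C0; rewrite exprDn_comm // big_ord_recl big_ord_recr /=.
rewrite big1 ?add0r => [|j _].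
  by rewrite subn0 subnn bin0 binn !mulr1n mulr1 mul1r.
by rewrite -mulr_natr C0 ?mulr0 // /bump /=; have := ltn_ord j; lia.
Qed.

(** The vanishing binomials make the i-th iterate of v |-> v x - x v equal to
    v |-> v x^i - x^i v = 0. A nilpotent inner derivation that is not zero
    yields an a with x^-1 a x = a + 1, and then the central element a^i
    equals (a + 1)^i = a^i + 1. *)
Lemma all_central_of_additive_pow i : (0 < i)%N ->
  (forall j, (0 < j < i)%N -> 'C(i, j)%:R = 0 :> D) ->
  (forall x, central (x ^+ i)) -> forall x, central x.
Proof.
move=> i0 C0 cX x; apply: NNPP => /noncentralP[y yx].
pose dl z := z * x - x * z.
(* evaluation at x makes X act as right multiplication by x *)
have iterE k : iter k dl y = (('X - x%:P) ^+ k * y%:P).[x].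
  elim: k => [|k IH] /=; first by rewrite mul1r hornerC.
  rewrite exprS -mulrA mulrBl hornerD hornerN hornerCM -commr_polyX hornerMX.
  by rewrite -IH.
have iter0 : iter i dl y = 0.
  rewrite iterE exprD_of_bin0 //; first last.
  - by move=> j /C0; rewrite -polyC_natr => ->.
  - exact/commrN/commr_sym/commr_polyX.
  rewrite -polyCN -rmorphXn /= mulrDl hornerD -commr_polyXn !hornerCM hornerXn hornerC.
  have -> : (- x) ^+ i = - x ^+ i.
    apply/eqP; rewrite -addr_eq0; apply/eqP.
    rewrite -exprD_of_bin0 ?addNr ?expr0n ?gtn_eqF //.
    exact/commr_sym/commrN.
  by rewrite mulNr (cX x y) subrr.
have ex0 : exists k, iter k dl y == 0 by exists i; apply/eqP.
case: (ex_minnP ex0) => [[|[|k]]] /eqP k0 kmin.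
- by move: yx; rewrite [y]k0 mul0r mulr0 subrr.
- exact: yx.
pose v := iter k dl y; pose u := dl v.
have u0 : u <> 0 by move/eqP => u0; have := kmin k.+1 u0; rewrite ltnn.
have ux : u * x = x * u by apply/subr0_eq.
have uu := unit_of_neq0 divD u0.
have uVx : u^-1 * x = x * u^-1.
  by apply: (mulrI uu); rewrite mulVKr // mulrA ux mulrK.
(* v u^-1 has commutator 1 with x, because u commutes with x *)
pose a := v * u^-1 * x.
have ax : a * x = x * (a + 1).
  apply/subr0_eq; rewrite mulrDr mulr1 opprD addrA; apply/eqP.
  rewrite subr_eq0; apply/eqP.
  transitivity (u * u^-1 * x); last by rewrite divrr // mul1r.
  have ud : u = v * x - x * v by [].
  by rewrite [X in X / _]ud !mulrBl /a -[v * x * u^-1]mulrA -uVx !mulrA.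
have aX k' : a ^+ k' * x = x * (a + 1) ^+ k'.
  elim: k' => [|k' IH]; first by rewrite mul1r mulr1.
  by rewrite exprS -mulrA IH mulrA ax -mulrA -exprS.
have := aX i; rewrite exprD_of_bin0 //; last exact: commr1.
rewrite (cX a x) mulrDr expr1n mulr1 -[LHS]addr0 => /addrI x0.
by apply: yx; rewrite -x0 mulr0 mul0r subrr.
Qed.

Hypothesis infZ : ~ finite_pred (@central D).

Lemma exists_central_notin (s : seq D) : exists2 z, central z & z \notin s.
Proof.
apply: NNPP => nz; apply: infZ; apply: (@sub_finite_pred _ _ s) => z cz.
by apply/negPn/negP => zs; apply: nz; exists z.
Qed.

(** A nonzero polynomial over a division ring has no more central roots than its
    degree. *)
Lemma poly_central_eq0 (p : {poly D}) :
  (forall z, central z -> z != 0 -> p.[z] = 0) -> p = 0.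
Proof.
move=> pZ; apply: NNPP => /eqP p0.
have [rs [sz urs cz rz]] : exists rs, [/\ size rs = size p, uniq rs,
    (forall z, z \in rs -> central z) & all (root p) rs].
  elim: (size p) => [|k [rs [sz urs cz rz]]]; first by exists [::].
  have [z cz' /norP[z0 zrs]] := exists_central_notin (0 :: rs).
  exists (z :: rs); rewrite /= sz zrs urs rz rootE pZ // eqxx; split => //.
  by move=> w; rewrite inE => /orP[/eqP->|/cz].
suff : (size rs < size p)%N by rewrite sz ltnn.
apply: max_ring_poly_roots => //; elim: (rs) urs cz => //= z l IH.
move=> /andP[zl ul] cz; apply/andP; split; last first.
  by apply: IH => // w wl; apply: cz; rewrite inE wl orbT.
apply/allP => w wl; rewrite /diff_roots cz ?mem_head // eqxx /=.
by apply: divD; rewrite subr_eq0; apply: contraNneq zl => <-.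
Qed.

Lemma coefs_central_eq0 N (E : nat -> D) :
  (forall z, central z -> z != 0 -> \sum_(j < N) E j * z ^+ j = 0) ->
  forall j, (j < N)%N -> E j = 0.
Proof.
move=> EZ j jN; have e : \poly_(j < N) E j = 0.
  by apply: poly_central_eq0 => z cz z0; rewrite horner_poly EZ.
by have := congr1 (fun p : {poly D} => p`_j) e; rewrite coef_poly jN coef0.
Qed.

Lemma coefs_central_square_eq0 N (E : nat -> D) :
  (forall z, central z -> z != 0 -> \sum_(j < N) E j * (z ^+ 2) ^+ j = 0) ->
  forall j, (j < N)%N -> E j = 0.
Proof.
move=> EZ j jN.
have e : \sum_(i < N) (E i)%:P * 'X^(2 * i) = 0 :> {poly D}.
  apply: poly_central_eq0 => z cz z0; rewrite -[RHS](EZ z) // horner_sum.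
  by apply: eq_bigr => i _; rewrite hornerCM hornerXn exprM.
have := congr1 (fun p : {poly D} => p`_(2 * j)) e; rewrite coef0 coef_sum.
rewrite (bigD1 (Ordinal jN)) //= coefCM coefXn eqxx mulr1 big1 ?addr0 // => i ij.
rewrite coefCM coefXn eqn_mul2l /= eq_sym.
by move: ij; rewrite -val_eqE /= => /negPf->; rewrite mulr0.
Qed.

(** Taking coefficients in (1 + x z)^i for central z, every x^j with C(i, j) <> 0
    is central too; so the least such i has only zero inner binomials and
    [all_central_of_additive_pow] applies. *)
Lemma all_central_of_pow i : (0 < i)%N -> (forall x, central (x ^+ i)) ->
  forall x, central x.
Proof.
have [k] := ubnP i; elim: k i => // k IH i ik i0 cX.
have [[j [/andP[j0 ji] Cij]]|C0] :=
    classic (exists j, (0 < j < i)%N /\ 'C(i, j)%:R <> 0 :> D); last first.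
  apply: (all_central_of_additive_pow i0) cX => j ji; apply: NNPP => Cij.
  by apply: C0; exists j.
apply: (IH j) => // [|x u]; first by lia.
have := @coefs_central_eq0 i.+1
  (fun l => 'C(i, l)%:R * (x ^+ l * u - u * x ^+ l)) _ j.
move=> H; apply/subr0_eq; apply: (div_mulf_eq0 divD) Cij.
apply: H; last by lia.
move=> z cz _; transitivity ((1 + x * z) ^+ i * u - u * (1 + x * z) ^+ i).
  rewrite exprDn_comm; last exact/commr_sym/commr1.
  rewrite mulr_suml mulr_sumr -sumrB; apply: eq_bigr => l _.
  rewrite expr1n mul1r exprMn_comm; last exact/commr_sym/cz.
  have czl := centralX l cz; have cC := @central_nat D 'C(i, l).
  rewrite -[(_ * _) *+ _]mulr_natl !mulrBr !mulrBl; congr (_ - _); rewrite -!mulrA.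
    by rewrite (czl u).
  by rewrite mulrA (cC u) -!mulrA.
by rewrite (cX _ u) subrr.
Qed.

Lemma hornerM_central (p q : {poly D}) z :
  central z -> (p * q).[z] = p.[z] * q.[z].
Proof. by move=> cz; rewrite hornerM_comm // /comm_poly (cz q.[z]). Qed.

Lemma hornerX_central (p : {poly D}) n z :
  central z -> (p ^+ n).[z] = p.[z] ^+ n.
Proof. by move=> cz; rewrite horner_exp_comm // /comm_poly (cz p.[z]). Qed.

(** The line x + z^2 y as a polynomial in the central parameter z. Squares
    appear because the identities control f(z^2 x), not f(z x). *)
Definition square_line x y : {poly D} := x%:P + y%:P * 'X^2.

Lemma horner_square_line x y z : (square_line x y).[z] = x + y * z ^+ 2.
Proof. by rewrite hornerD hornerC hornerCM hornerXn. Qed.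

Lemma coef_square_line x y :
  ((square_line x y)`_0 = x) * ((square_line x y)`_1 = 0) *
  ((square_line x y)`_2 = y).
Proof.
by rewrite /square_line !coefD !coefC !coefCM !coefXn /= !mulr0 !mulr1 !addr0 add0r.
Qed.

Lemma coef0X (p : {poly D}) n : (p ^+ n)`_0 = p`_0 ^+ n.
Proof. by elim: n => [|n IH]; rewrite ?coef1 // !exprS coef0M IH. Qed.

(** The coefficient of X^2 in A B = B A, for A = x + y X^2, is the relation
    x B_2 + y B_0 = B_2 x + B_0 y. *)
Lemma coef0_commute x y (B : {poly D}) :
  GRing.comm (square_line x y) B -> B`_2 = 0 -> B`_0 * y = y * B`_0.
Proof.
move=> /(congr1 (fun p : {poly D} => p`_2)); rewrite !coefM.
rewrite !big_ord_recl !big_ord0 /= /bump /= !addn0 !coef_square_line.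
by move=> e B2; move: e; rewrite B2 !mul0r !mulr0 !addr0 !add0r => ->.
Qed.

Section Scaling.
Variables (f : {additive D -> D}) (n : nat).
Hypothesis fZ : forall z x, central z -> f (z * z * x) = z ^+ n * f x.

Lemma scale_square x z : central z -> f (x * z ^+ 2) = f x * z ^+ n.
Proof.
move=> cz; rewrite -(centralX 2 cz x) expr2 fZ //; exact: centralX.
Qed.

(** If f(x) <> 0 = f(y), then f(y + z^2 x) <> 0 for all central z <> 0, so
    (y + z^2 x)^i is central for infinitely many z, hence also at z = 0. *)
Lemma all_central_of_pow_on_support i : (0 < i)%N ->
  (forall x, f x <> 0 -> central (x ^+ i)) ->
  (exists x, f x <> 0) -> forall x, central x.
Proof.
move=> i0 fi [x fx]; apply: (all_central_of_pow i0) => y.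
have [fy|/fi//] := classic (f y = 0); move=> u; apply/subr0_eq.
pose A := square_line y x.
have AE : A ^+ i * u%:P - u%:P * A ^+ i = 0.
  apply: poly_central_eq0 => z cz z0.
  rewrite hornerD hornerN !hornerM_central // hornerX_central // hornerC.
  rewrite horner_square_line (fi _ _ u) ?subrr // raddfD fy add0r scale_square //.
  apply/eqP/(div_neq0 divD); first exact/eqP.
  by apply: contraTneq (unitrX n (divD z0)) => ->; rewrite unitr0.
have := congr1 (fun p : {poly D} => p`_0) AE.
by rewrite coefB !coef0M coef0X !coef_square_line coefC coef0.
Qed.

(** In f((x + z^2 y)^2) only the powers z^0, z^n and z^(2n) occur. As n > 2, the
    coefficient of z^2 on the right, which is B_2 a, must vanish. *)
Lemma square_line_identity x y a b (B : {poly D}) : (2 < n)%N ->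
  GRing.comm (square_line x y) B ->
  (forall z, central z -> f ((x + y * z ^+ 2) * (x + y * z ^+ 2))
                          = B.[z] * (a + b * z ^+ n)) ->
  a <> 0 -> B`_0 * y = y * B`_0.
Proof.
move=> n2 cB fB a0; apply: coef0_commute cB _; apply: (div_mulf_eq0r divD) a0.
pose Q := B * (a%:P + b%:P * 'X^n)
  - ((f (x * x))%:P + (f (x * y + y * x))%:P * 'X^n
     + (f (y * y))%:P * 'X^(n + n)).
have Q0 : Q = 0.
  apply: poly_central_eq0 => z cz _.
  rewrite hornerD hornerN hornerM_central // !hornerD !hornerCM !hornerC !hornerXn.
  rewrite -fB //; apply/eqP; rewrite subr_eq0; apply/eqP.
  have -> : (x + y * z ^+ 2) * (x + y * z ^+ 2) =
      x * x + (x * y + y * x) * z ^+ 2 + y * y * z ^+ 2 * z ^+ 2.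
    have := centralX 2 cz; move: (z ^+ 2) => w cw.
    have e1 : y * w * x = y * x * w by rewrite -mulrA cw mulrA.
    have e2 : y * w * (y * w) = y * y * w * w.
      by rewrite -mulrA [w * _]mulrA (cw y) !mulrA.
    by rewrite !mulrDl !mulrDr e1 e2 mulrA -!addrA.
  by rewrite raddfD /= raddfD /= !scale_square // exprD !mulrA.
have := congr1 (fun p : {poly D} => p`_2) Q0.
rewrite coefB mulrDr mulrA !coefD !coefMXn coefMC !coefC /=.
have -> : (2 < n + n)%N by lia.
by rewrite n2 /= !addr0 subr0.
Qed.

End Scaling.
End InfiniteCentre.

(** * Consequences of the inverse relation *)

Section Identities.
Set Implicit Arguments.
Unset Strict Implicit.
Variables (D : unitRingType) (divD : division_ring D).
Implicit Types (x y z u v : D) (f g h : {additive D -> D}).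

Definition power_reflected n f g :=
  forall x, x \is a GRing.unit -> f x = x ^+ n * g x^-1.

Definition power_defect (R : nzRingType) n (x : R) : R := (1 + x) ^+ n - 1 - x ^+ n.

Lemma power_reflected_sym n f g : power_reflected n f g -> power_reflected n g f.
Proof.
move=> fg x ux; rewrite fg ?unitrV // invrK mulrA -exprMn_comm ?divrr //.
  by rewrite expr1n mul1r.
exact/commrV.
Qed.

Lemma power_reflected1 n f g : power_reflected n f g -> f 1 = g 1.
Proof. by move=> fg; rewrite fg ?unitr1 // expr1n mul1r invr1. Qed.

Lemma power_reflectedN n f g x : power_reflected n f g -> f x = (-1) ^+ n * f x.
Proof.
move=> fg; have [->|/divD ux] := eqVneq x 0; first by rewrite raddf0 mulr0.
have := fg (- x); rewrite unitrN invrN !raddfN mulrN => /(_ ux)/oppr_inj e.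
by rewrite {1}e (exprNn x) -mulrA -fg.
Qed.

(** A form of Hua's identity. *)
Lemma hua_inv x z : x \is a GRing.unit -> z \is a GRing.unit ->
  1 + x * z \is a GRing.unit ->
  (x + x * z * x)^-1 = x^-1 - (x + z^-1)^-1.
Proof.
move=> ux uz uq.
have -> : x + x * z * x = (1 + x * z) * x by rewrite mulrDl mul1r.
have -> : x + z^-1 = (1 + x * z) * z^-1 by rewrite mulrDl mul1r mulrK // addrC.
rewrite !invrM ?unitrV // invrK.
apply: (mulIr uq); rewrite mulrBl !mulrVK //.
by rewrite mulrDr mulr1 mulrA mulVr // mul1r addrK.
Qed.

(** Apply f to x + xzx = (x^-1 - (x + z^-1)^-1)^-1. The degenerate values
    x = 0, z = 0 and xz = -1 are allowed because n > 0; the last one uses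
    f(-x) = -f(x), which gives f = (-1)^n f. *)
Lemma square_mul_identity n f g x z : (0 < n)%N -> power_reflected n f g ->
  x * z = z * x ->
  f (x * x * z) = power_defect n (x * z) * f x - x ^+ n * g z.
Proof.
move=> n0 fg xz.
have [x0|/divD ux] := eqVneq x 0.
  by rewrite x0 !mul0r raddf0 mulr0 expr0n gtn_eqF // mul0r subr0.
have [z0|/divD uz] := eqVneq z 0.
  rewrite z0 /power_defect !mulr0 !raddf0 addr0 expr1n expr0n gtn_eqF //.
  by rewrite subrr subr0 mul0r mulr0 subr0.
have xxz : x * x * z = x * z * x by rewrite -!mulrA xz.
have [q0|/divD uq] := eqVneq (1 + x * z) 0.
  have xz1 : x * z = -1 by apply/eqP; rewrite -addr_eq0 addrC q0.
  have zE : z = - x^-1 by apply: (mulrI ux); rewrite xz1 mulrN divrr.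
  rewrite xxz xz1 mulN1r zE /power_defect subrr expr0n gtn_eqF // sub0r.
  rewrite !raddfN mulrN opprK -fg // mulrBl mulN1r -(power_reflectedN x fg).
  by rewrite addrAC addNr add0r.
pose q := 1 + x * z.
have cxq : GRing.comm x q by rewrite /GRing.comm mulrDr mulrDl mulr1 mul1r mulrA xxz.
have czq : GRing.comm z q.
  by rewrite /GRing.comm mulrDr mulrDl mulr1 mul1r mulrA -xz.
have e1 : x + x * z * x = x * q by rewrite mulrDr mulr1 mulrA xxz.
have e2 : x + z^-1 = q * z^-1 by rewrite mulrDl mul1r mulrK // addrC.
have fw : f (x + x * z * x) = (1 + x * z) ^+ n * f x - (x * z) ^+ n * (f x + f z^-1).
  rewrite fg; last by rewrite e1 unitrMr.
  rewrite hua_inv // raddfB mulrBr; congr (_ - _).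
    rewrite e1 exprMn_comm // -(commrX n (commr_sym (commrX n cxq))).
    by rewrite -mulrA -fg.
  have gi : g (x + z^-1)^-1 = (x + z^-1)^-1 ^+ n * (f x + f z^-1).
    rewrite -raddfD (power_reflected_sym fg) ?invrK //.
    by rewrite unitrV e2 unitrMr // unitrV.
  rewrite gi mulrA; congr (_ * _).
  rewrite e1 e2 invrM ?unitrV // invrK -exprMn_comm.
    by rewrite -mulrA [q * _]mulrA -czq mulrK.
  have cxqq : GRing.comm (x * q) q by apply/commr_sym/commrM => //; exact/commr_sym.
  apply: commrM; last exact: commrV.
  by apply/commr_sym/commrM => //; apply: esym.
have fz : (x * z) ^+ n * f z^-1 = x ^+ n * g z.
  rewrite fg ?unitrV // invrK mulrA -exprMn_comm ?mulrK //; apply: commrV.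
  by apply: commr_sym; apply: commrM => //; apply: esym.
rewrite xxz -[LHS](addKr (f x)) -raddfD fw mulrDr fz /power_defect.
by rewrite !mulrBl mul1r opprD !addrA [- f x + _]addrC.
Qed.

Lemma reflected_sum n f g z : (0 < n)%N -> power_reflected n f g ->
  f z + g z = power_defect n z * f 1.
Proof.
move=> n0 fg; have := square_mul_identity n0 fg (commr_sym (commr1 z)).
by rewrite !mul1r expr1n mul1r => ->; rewrite subrK.
Qed.

Lemma exists_noncentral : noncommutative D -> exists b : D, ~ central b.
Proof.
move=> ncD; apply: NNPP => nb; apply: ncD => x y; suff : central x by apply.
by apply: NNPP => ncx; apply: nb; exists x.
Qed.

Lemma not_all_central : noncommutative D -> ~ forall x : D, central x.
Proof. by move=> ncD cD; apply: ncD => x y; apply: cD. Qed.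

(** Here f(xzx) = -f(x) - g(z) unless z or 1 + xz is 0. For x noncentral, the
    values z = b, 1, b + 1 are all permitted when b does not commute with x,
    and additivity leaves f(x) = 0. *)
Lemma power_reflected0 f g : noncommutative D -> power_reflected 0 f g ->
  forall x, f x = 0.
Proof.
move=> ncD fg; have f0 x : ~ central x -> f x = 0.
  move=> ncx; have [b bx] := noncentralP ncx.
  have x0 : x != 0.
    by apply: contra_notN ncx => /eqP->; apply: central0.
  have ux := divD x0.
  have fgu u : u \is a GRing.unit -> f u = g u^-1 by move/fg; rewrite mul1r.
  have sandwich z : z != 0 -> 1 + x * z != 0 -> f (x * z * x) = - f x - g z.
    move=> /divD uz /divD uq; apply: (addrI (f x)); rewrite addNKr -raddfD.
    have e1 : x + x * z * x = (1 + x * z) * x by rewrite mulrDl mul1r.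
    have e2 : x + z^-1 = (1 + x * z) * z^-1 by rewrite mulrDl mul1r mulrK // addrC.
    rewrite fgu; last by rewrite e1 unitrMr.
    rewrite hua_inv // raddfB -!fgu //; last by rewrite e2 unitrMr // unitrV.
    by rewrite raddfD opprD addrA subrr sub0r fgu ?unitrV // invrK.
  have ok u : u * x - x * u <> 0 -> u != 0 /\ 1 + x * u != 0.
    move=> uv; split; apply: contra_notN uv => /eqP.
      by move->; rewrite mul0r mulr0 subrr.
    move/eqP; rewrite addrC addr_eq0 => /eqP xu.
    have -> : u = - x^-1 by apply: (mulrI ux); rewrite xu mulrN divrr.
    by rewrite mulNr mulrN mulVr // divrr // subrr.
  have [b0 xb] := ok b bx.
  have [b10 xb1] : b + 1 != 0 /\ 1 + x * (b + 1) != 0.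
    by apply: ok; rewrite mulrDl mulrDr mul1r mulr1 opprD addrACA subrr addr0.
  have x1 : 1 + x * 1 != 0.
    apply: contra_notN ncx; rewrite mulr1 addrC addr_eq0 => /eqP->.
    exact/centralN/central1.
  have := sandwich _ b10 xb1.
  rewrite mulrDr mulrDl !raddfD sandwich // sandwich ?oner_eq0 //=.
  set p := f x; set q := g b; set r := g 1 => e.
  apply: oppr_inj; rewrite oppr0; apply: (addIr (- p - (q + r))).
  rewrite add0r opprD -{2}e [RHS]addrACA; apply: addrA.
have [b ncb] := exists_noncentral ncD.
move=> x; have [cx|/f0//] := classic (central x).
rewrite -[x](addrK b) raddfB !f0 ?subrr // => cxb; apply: ncb.
by rewrite -[b](addKr x); apply: centralD cxb; apply: centralN.
Qed.

Section JordanLeft.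
Variable f : {additive D -> D}.
Hypothesis two_neq0 : 2%:R <> 0 :> D.
Hypothesis f_square : forall x, f (x * x) = (x * f x) *+ 2.

Lemma double_inj u v : u *+ 2 = v *+ 2 -> u = v.
Proof.
move/eqP; rewrite -subr_eq0 -mulrnBl -mulr_natl => /eqP uv.
by apply/subr0_eq/(div_mulf_eq0 divD uv).
Qed.

Lemma jordan_left_polar u v : f (u * v + v * u) = (u * f v + v * f u) *+ 2.
Proof.
have sq (p q r s : D) : p + q + (r + s) = p + s + (q + r).
  by rewrite [r + s]addrC addrACA.
have := f_square (u + v); rewrite raddfD 2!mulrDl !mulrDr.
rewrite [X in f X]sq [X in X *+ 2]sq raddfD mulrnDl.
rewrite [f (u * u + v * v)]raddfD !f_square !mulrnDl; exact: addrI.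
Qed.

Lemma jordan_left_sandwich x y :
  f (x * y * x) = x * x * f y + x * y * f x *+ 3 - y * x * f x.
Proof.
apply: double_inj.
transitivity (f (x * (x * y + y * x) + (x * y + y * x) * x)
              - f (x * x * y + y * (x * x))).
  rewrite -raddfB -raddfMn; congr (f _).
  rewrite mulrDr mulrDl !mulrA mulr2n opprD addrACA.
  by rewrite [x * x * y + _]addrC addrK addrK.
rewrite !jordan_left_polar f_square -mulrnBl; congr (_ *+ 2).
rewrite !mulrnAr mulrDr mulrDl !mulrA.
move: (x * x * f y) (x * y * f x) (y * x * f x) => A B C.
apply/eqP; rewrite subr_eq; apply/eqP.
rewrite -[RHS]addrA [- C + _]addrCA mulrnDl !mulr2n addKr [RHS]addrACA -[LHS]addrA.
by congr (_ + _);  rewrite mulrSr mulr2n addrA.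
Qed.

(** Computing f((xy)^2 + (yx)^2) once from the squares and once as
    f((xyx) y + y (xyx)) determines [x, y] f(xy); replacing y by x + y gives
    the claim. *)
Lemma jordan_left_commutator x y :
  ((x * y - y * x) * x - x * (x * y - y * x)) * f x = 0.
Proof.
have comm1 z : (x * z - z * x) * f (x * z) =
    (x * z - z * x) * x * f z + z * (x * z - z * x) * f x.
  have yxE : f (z * x) = (x * f z + z * f x) *+ 2 - f (x * z).
    by rewrite -jordan_left_polar raddfD /= [RHS]addrC addKr.
  have E : x * z * f (x * z) + z * x * f (z * x)
         = x * z * x * f z + z * f (x * z * x).
    apply: double_inj; rewrite -jordan_left_polar mulrnDl.
    by rewrite -!f_square -raddfD !mulrA.
  move: E; rewrite yxE jordan_left_sandwich !(mulrBr, mulrnAr, mulrDr).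
  rewrite !mulrBl !mulrA.
  move: (x * z * f (x * z)) (z * x * f (x * z)) => a b.
  move: (z * x * x * f z) (z * x * z * f x) => p q.
  move: (x * z * x * f z) (z * z * x * f x) => r s E.
  apply: (addIr ((p + q) *+ 2)); rewrite addrAC -[LHS]addrA E.
  rewrite mulrnDl [RHS]addrACA -[r - p + _]addrA mulr2n addKr.
  by rewrite [q - s + _]addrAC -mulrS !addrA.
(* comm1 at x + y minus comm1 at y *)
pose w := x * y - y * x.
have wE : x * (x + y) - (x + y) * x = w.
  by rewrite mulrDr mulrDl opprD addrACA subrr add0r.
have := comm1 (x + y); rewrite wE mulrDr [f (_ + _)]raddfD f_square.
rewrite mulrDr [w * f (x * y)]comm1 -/w [f (x + y)]raddfD mulrDr.
rewrite [(x + y) * w]mulrDl [w * x * (_ + _)]mulrDr.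
rewrite [(x * w + y * w) * f x]mulrDl.
rewrite [w * x * f x + _ + _]addrACA => /addIr; rewrite mulrA => /addrI e.
by rewrite mulrBl e subrr.
Qed.

(** If f(x) <> 0 then d = [x, -] satisfies d^2 = 0. Expanding d^2(y y) gives
    2 d(y)^2 = 0, so d = 0. *)
Lemma jordan_left_support_central x : f x <> 0 -> central x.
Proof.
move=> fx0; apply: NNPP => /noncentralP[y yx].
pose dl z := x * z - z * x.
have dl2 z : dl (dl z) = 0.
  by have /(div_mulf_eq0r divD)/(_ fx0) /eqP := jordan_left_commutator x z;
  rewrite subr_eq0 => /eqP e; rewrite /dl -e subrr.
have dlM u v : dl (u * v) = dl u * v + u * dl v.
  by rewrite /dl mulrBl mulrBr !mulrA addrA subrK.
have dlD u v : dl (u + v) = dl u + dl v.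
  by rewrite /dl mulrDr mulrDl opprD addrACA.
have := dl2 (y * y); rewrite dlM dlD !dlM !dl2 mul0r mulr0 add0r addr0 => dy2.
have {}dy2 : dl y * dl y = 0 by apply: double_inj; rewrite mulr2n mul0rn.
have dy0 : dl y <> 0 by move=> e; apply: yx; rewrite -opprB -/(dl y) e oppr0.
exact: dy0 (div_mulf_eq0 divD dy2 dy0).
Qed.
End JordanLeft.
End Identities.

(** * Vanishing of f *)

Section Vanishing.
Set Implicit Arguments.
Unset Strict Implicit.
Variables (D : unitRingType) (divD : division_ring D) (ncD : noncommutative D).
Implicit Types (x y z u v : D) (f g h : {additive D -> D}).

(** Conjugating by u leaves f(x) and f(x^-1) unchanged but replaces x^n by its
    conjugate in f(x) = -x^n f(x^-1); so x^n is central whenever f(x) <> 0. *)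
Lemma tracial_eq0 n f : (0 < n)%N ->
  (forall x, x \is a GRing.unit -> f x = - (x ^+ n * f x^-1)) ->
  (forall x y, f (x * y) = f (y * x)) ->
  (forall z x, central z -> f (z * z * x) = z ^+ n * f x) ->
  forall x, f x = 0.
Proof.
move=> n0 frefl ftr fZ.
have supp x : f x <> 0 -> central (x ^+ n).
  move=> fx u; have [->|/divD uu] := eqVneq u 0; first by rewrite mul0r mulr0.
  have ux : x \is a GRing.unit.
    by apply: (unit_of_neq0 divD) => x0; apply: fx; rewrite x0 raddf0.
  have conj y : f (u * y / u) = f y by rewrite -mulrA ftr mulrVK.
  have conjX k : (u * x / u) ^+ k = u * x ^+ k / u.
    elim: k => [|k IH]; first by rewrite mulr1 divrr.
    by rewrite !exprS IH -!mulrA mulKr.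
  have fxV : f x^-1 <> 0.
    by move=> e; apply: fx; rewrite frefl // e mulr0 oppr0.
  have := conj x; rewrite frefl ?unitrMr ?unitrMl ?unitrV //.
  rewrite conjX !invrM ?unitrV ?unitrMr // invrK mulrA conj [in RHS]frefl //.
  move=> /oppr_inj /eqP; rewrite -subr_eq0 -mulrBl => /eqP.
  move/(div_mulf_eq0r divD)/(_ fxV)/subr0_eq/(congr1 ( *%R^~ u)).
  by rewrite /= mulrVK.
have [finZ|infZ] := classic (finite_pred (@central D)); last first.
  move=> x; apply: NNPP => fx; apply: (not_all_central ncD).
  by apply: (all_central_of_pow_on_support divD infZ fZ n0 supp); exists x.
(* With M the exponent of the units of Z, x^(nM) f(x) = f(x) for all x,
   which is additive. *)
have [M M0 MP] := central_exponent divD finZ.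
apply: (@degree_ltX_eq0 _ divD finZ ncD (n * M)%N).
apply: (@eq_degree_lt _ _ f) => [x|].
  have [->|fx] := classic (f x = 0); first by rewrite mulr0.
  rewrite exprM MP ?mul1r //; first exact: supp.
  have ux : x \is a GRing.unit.
    by apply: (unit_of_neq0 divD) => x0; apply: fx; rewrite x0 raddf0.
  by move=> e; have := unitrX n ux; rewrite e unitr0.
apply: degree_lt_leq (degree_lt_additive f).
by rewrite ltnS muln_gt0 n0.
Qed.

(** If f vanishes on xy + yx and 2 f = 0, then f(xy) = f(yx). *)
Lemma reflected_square_eq0 n f g : (0 < n)%N -> power_reflected n f g ->
  (forall x, power_defect n x = 0) -> (forall x y, f (x * y + y * x) = 0) ->
  (forall x, f x + f x = 0) -> forall x, f x = 0.
Proof.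
move=> n0 fg pd0 fxy f2.
have gE x : g x = - f x.
  by apply/eqP; rewrite -addr_eq0 addrC (reflected_sum divD _ n0 fg) pd0 mul0r.
apply: (tracial_eq0 n0).
- by move=> x ux; rewrite fg // gE mulrN.
- move=> x y; have /eqP := fxy x y; rewrite raddfD addr_eq0 => /eqP->.
  by apply/eqP; rewrite eq_sym -addr_eq0 f2.
- move=> z x cz; rewrite (square_mul_identity divD n0 fg) ?(cz x) // pd0.
  by rewrite mul0r sub0r gE mulrN opprK.
Qed.

Lemma reflected2_eq0 f g : power_reflected 2 f g -> f 1 = 0 -> forall x, f x = 0.
Proof.
move=> fg f1; have g1 : g 1 = 0 by rewrite -(power_reflected1 fg).
have pdE x : power_defect 2 x = x *+ 2.
  rewrite /power_defect !expr2 mulrDl !mulrDr !mul1r mulr1 !addrA [_ - 1 - _]addrAC addrK.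
  by rewrite -[1 + x + x]addrA addrC addKr mulr2n.
have f_square x : f (x * x) = (x * f x) *+ 2.
  have := square_mul_identity divD (ltn0Sn 1) fg (commr1 x).
  by rewrite !mulr1 pdE mulrnAl g1 mulr0 subr0.
have [two0|two0] := classic (2%:R = 0 :> D); last first.
  move=> x; apply: NNPP => fx; apply: (not_all_central ncD) => y.
  have cs := jordan_left_support_central divD two0 f_square.
  have [fy|/cs//] := classic (f y = 0).
  rewrite -[y](addrK x); apply: centralB; last exact: cs.
  by apply: cs; rewrite raddfD fy add0r.
have dbl u : u *+ 2 = 0 :> D by rewrite -mulr_natl two0 mul0r.
apply: (reflected_square_eq0 _ fg) => // [x|x y|x].
- by rewrite pdE dbl.
- by rewrite (jordan_left_polar f_square) dbl.
by rewrite -mulr2n dbl.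
Qed.

(** Coefficients of [power_defect n]: no constant term, and no term of
    degree n. *)
Definition inner_binomial n i := if i is 0 then 0%N else 'C(n, i).

Lemma power_defectE n x : (0 < n)%N ->
  power_defect n x = \sum_(i < n) (inner_binomial n i)%:R * x ^+ i.
Proof.
case: n => // n _; rewrite /power_defect exprDn_comm; last exact/commr_sym/commr1.
rewrite big_ord_recr /= binn expr1n mul1r addrAC mulr1n addrK.
rewrite !big_ord_recl /= bin0 expr1n mul1r mul0r add0r addrAC subrr add0r.
by apply: eq_bigr => i _; rewrite expr1n mul1r mulr_natl.
Qed.

Lemma power_defect_top n i0 : (0 < i0 < n)%N -> 'C(n, i0)%:R <> 0 :> D ->
  exists m, [/\ (i0 <= m)%N, (inner_binomial n m)%:R <> 0 :> D &
    forall x, power_defect n x = \sum_(i < m.+1) (inner_binomial n i)%:R * x ^+ i].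
Proof.
move=> /andP[i00 i0n] C0.
pose Q i := (i < n)%N && ((inner_binomial n i)%:R != 0 :> D).
have Qi0 : Q i0 by rewrite /Q i0n; case: (i0) i00 C0 => //= i _ /eqP.
have Qn i : Q i -> (i <= n)%N by case/andP=> /ltnW.
case: (ex_maxnP (ex_intro _ i0 Qi0) Qn) => m /andP[mn /eqP Cm] mmax.
exists m; split => // [|x]; first exact: mmax.
have n0 : (0 < n)%N by apply: leq_trans mn.
rewrite power_defectE // -!(big_mkord xpredT (fun i => (inner_binomial n i)%:R * x ^+ i)).
rewrite (big_cat_nat _ mn) //= [X in _ + X]big_nat [X in _ + X]big1 ?addr0 // => i /andP[mi iN].
have [->|Ci] := eqVneq ((inner_binomial n i)%:R : D) 0; first by rewrite mul0r.
by have := mmax i; rewrite /Q iN Ci => /(_ isT); rewrite leqNgt mi.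
Qed.

(** Stated over any ring because it is also used for polynomials. *)
Lemma power_defect_comm (R : nzRingType) n (x y : R) :
  GRing.comm y x -> GRing.comm y (power_defect n x).
Proof.
move=> yx; apply: commrB; first apply: commrB; try exact: commr1.
  by apply/commrX/commrD => //; apply: commr1.
exact: commrX.
Qed.

Section Reflected.
Variables (n : nat) (f g : {additive D -> D}).
Hypotheses (n0 : (0 < n)%N) (fg : power_reflected n f g).

Lemma reflected_square x : f 1 = 0 -> f (x * x) = power_defect n x * f x.
Proof.
move=> f1; have := square_mul_identity divD n0 fg (commr1 x).
by rewrite -(power_reflected1 fg) f1 mulr0 subr0 !mulr1.
Qed.

Lemma reflected_opp x : power_defect n x * f 1 = 0 -> g x = - f x.
Proof.
by move=> e; apply/eqP; rewrite -addr_eq0 addrC (reflected_sum divD _ n0 fg) e.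
Qed.

Lemma scale_central z x : central z -> f z = 0 -> g x = - f x ->
  f (z * z * x) = z ^+ n * f x.
Proof.
move=> cz fz gx; rewrite (square_mul_identity divD n0 fg) ?(cz x) //.
by rewrite fz mulr0 sub0r gx mulrN opprK.
Qed.

Section SomeBinomial.
Variable i0 : nat.
Hypotheses (i0_gt1 : (1 < i0)%N) (i0n : (i0 < n)%N).
Hypothesis C0 : 'C(n, i0)%:R <> 0 :> D.

(** Both (f + g)(x) = P(x) f(1) and f(x^2) = P(x) f(x) compare a map of degree
    1 or 2 with one of degree m or m + 1, where m > 1 is the degree of P. *)
Lemma reflected_eq0_finite : finite_pred (@central D) -> forall x, f x = 0.
Proof.
move=> finZ.
have i0P : (0 < i0 < n)%N by rewrite i0n (ltnW i0_gt1).
have [m [im Cm pdE]] := power_defect_top i0P C0.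
have m1 : (1 < m)%N by apply: leq_trans im.
have f1 : f 1 = 0.
  pose e : {additive D -> D} := f 1 \o* idfun.
  have e0 u : e u = 0.
    apply: (@leading_eq0 _ divD finZ ncD m.-1 (fun i => inner_binomial n i.+1)).
      pose fg' : {additive D -> D} := f \+ g.
      apply: (@eq_degree_lt _ _ fg') => [v|].
        rewrite /= (reflected_sum divD _ n0 fg) pdE big_ord_recl mul0r add0r.
        rewrite prednK; last exact: ltnW.
        rewrite mulr_suml; apply: eq_bigr => i _.
        by rewrite /e /= /bump /= add1n exprSr !mulrA.
      by apply: degree_lt_leq (degree_lt_additive fg'); rewrite prednK // ltnW.
    by rewrite prednK // ltnW.
  by have := e0 1; rewrite /e /= mul1r.
apply: (@leading_eq0 _ divD finZ ncD m (inner_binomial n)) Cm.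
apply: (@eq_degree_lt _ _ (fun u => f (u * u))) => [u|].
  by rewrite reflected_square // pdE mulr_suml; apply: eq_bigr => i _; rewrite mulrA.
exact: degree_lt_leq (degree_lt_square f).
Qed.

Hypothesis infZ : ~ finite_pred (@central D).

Lemma inner_binomial_i0 : inner_binomial n i0 = 'C(n, i0).
Proof. by case: (i0) i0_gt1. Qed.

(** If f(z) <> 0 for some central z, then P(z y) f(z) = f(z^2 y) + z^n g(y)
    shows that P is additive. As P(v) commutes with v, polarization gives
    [P(x), y] = [x, P(y)]; replacing y by y w and taking the coefficient of
    w^i0 gives [x, y^i0] = 0. *)
Lemma reflected_central_eq0 z : central z -> f z = 0.
Proof.
move=> cz; apply: NNPP => fz; apply: (not_all_central ncD).
apply: (all_central_of_pow divD infZ (ltnW i0_gt1)) => y x.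
have uz : z \is a GRing.unit.
  by apply: (unit_of_neq0 divD) => z0; apply: fz; rewrite z0 raddf0.
have pdD u v : power_defect n (u + v) = power_defect n u + power_defect n v.
  have pdz w : power_defect n (z * w) * f z = f (z * z * w) + z ^+ n * g w.
    by rewrite (square_mul_identity divD n0 fg) ?(cz w) // subrK.
  have uf := unit_of_neq0 divD fz; apply: (mulIr uf).
  rewrite -[u](mulVKr uz) -[v](mulVKr uz).
  move: (z^-1 * u) (z^-1 * v) => a b; rewrite -mulrDr [RHS]mulrDl !pdz mulrDr.
  by rewrite !raddfD /= mulrDr addrACA.
pose d := power_defect n x * y - y * power_defect n x.
pose E i := (inner_binomial n i)%:R * (x * y ^+ i - y ^+ i * x) - (if i == 1%N then d else 0).
have : E i0 = 0.
  apply: (coefs_central_eq0 divD infZ (N := n)) => // w cw _.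
  have cpd v : v * power_defect n v = power_defect n v * v.
    exact: power_defect_comm.
  transitivity (x * power_defect n (y * w) - power_defect n (y * w) * x - d * w).
    rewrite (eq_bigr (fun i : 'I_n => (inner_binomial n i)%:R * (x * y ^+ i - y ^+ i * x) * w ^+ i
      - (if nat_of_ord i == 1%N then d * w else 0))).
      rewrite sumrB; congr (_ - _).
        rewrite power_defectE // mulr_suml mulr_sumr -sumrB; apply: eq_bigr => i _.
        have cwi := centralX i cw; have cC := @central_nat D (inner_binomial n i).
        rewrite exprMn_comm; last exact/commr_sym/cw.
        rewrite mulrBr mulrBl; congr (_ - _).
          by rewrite !mulrA -(cC x).
        by rewrite -!mulrA (cwi x).
      have n1 : (1 < n)%N by apply: ltn_trans i0n.
      by rewrite (bigD1 (Ordinal n1)) //= big1 ?addr0 // => j /negPf; rewrite -val_eqE /= => ->.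
    move=> i _; rewrite mulrBl; congr (_ - _); case: eqP => [->|]; rewrite ?expr1 ?mul0r //.
  have -> : d * w = power_defect n x * (y * w) - y * w * power_defect n x.
    by rewrite /d mulrBl -!mulrA (cw (power_defect n x)).
  move: (y * w) (cpd x) (cpd (y * w)) (cpd (x + y * w)) => v; rewrite pdD.
  move: (power_defect n x) (power_defect n v) => p q xp vq.
  rewrite !mulrDl !mulrDr xp vq -!addrA => /addrI; rewrite !addrA => /addIr e.
  apply/eqP; rewrite subr_eq0 subr_eq addrAC eq_sym subr_eq eq_sym; exact/eqP.
rewrite /E inner_binomial_i0 gtn_eqF // subr0 => e; apply/esym/subr0_eq.
exact: (div_mulf_eq0 divD e C0).
Qed.

(** The coefficient of z^2 in f((x + z^2 y)^2) = P(x + z^2 y) f(x + z^2 y) shows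
    that P(x) is central when f(x) <> 0. The same holds for P(x z^2), hence
    for each x^i with a nonzero coefficient in P, and
    [all_central_of_pow_on_support] concludes. *)
Lemma reflected_eq0_infinite x : f x = 0.
Proof.
have f1 : f 1 = 0 by apply/reflected_central_eq0/central1.
have gE y : g y = - f y by apply: reflected_opp; rewrite f1 mulr0.
have fZ z y : central z -> f (z * z * y) = z ^+ n * f y.
  by move=> cz; apply: scale_central => //; apply: reflected_central_eq0.
have n2 : (2 < n)%N by apply: leq_ltn_trans i0n.
have defect_central y : f y <> 0 -> central (power_defect n y).
  move=> fy u; pose A := square_line y u; pose B := power_defect n A.
  have B0 : B`_0 = power_defect n y.
    rewrite /B /power_defect !coefB !coef0X coefD !coef1 /=.
    by rewrite !coef_square_line.
  rewrite -B0; apply: (square_line_identity divD infZ fZ (b := f u) n2 _ _ fy).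
    exact: power_defect_comm.
  move=> z cz; rewrite reflected_square // raddfD (scale_square fZ) //.
  congr (_ * _); rewrite /B /power_defect !hornerD !hornerN !hornerX_central //.
  by rewrite hornerD !hornerC horner_square_line.
apply: NNPP => fx; apply: (not_all_central ncD).
apply: (all_central_of_pow_on_support divD infZ fZ (ltnW i0_gt1)); last by exists x.
move=> y fy u; apply/subr0_eq; apply: (div_mulf_eq0 divD) C0.
rewrite -inner_binomial_i0.
pose E i := (inner_binomial n i)%:R * (y ^+ i * u - u * y ^+ i).
apply: (@coefs_central_square_eq0 _ divD infZ n E) => // z cz z0.
have cz2 := centralX 2 cz.
transitivity (power_defect n (y * z ^+ 2) * u - u * power_defect n (y * z ^+ 2)).
  rewrite power_defectE // mulr_suml mulr_sumr -sumrB; apply: eq_bigr => i _.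
  have cwi := centralX i cz2; have cC := @central_nat D (inner_binomial n i).
  rewrite exprMn_comm; last exact/commr_sym/cz2.
  rewrite /E mulrBr mulrBl; congr (_ - _).
    by rewrite -!mulrA (cwi u).
  by rewrite !mulrA -(cC u).
rewrite defect_central ?subrr // (scale_square fZ) //.
apply/eqP/(div_neq0 divD); first exact/eqP.
by apply: contraTneq (unitrX n (divD z0)) => ->; rewrite unitr0.
Qed.
End SomeBinomial.

(** Now P = 0 and f(x^2) = x^n f(1). The polar form of the power map is zero
    for n = 1; for n > 2 the left side has degree 2 and the right side degree
    n, so f(1) = 0. Either way f vanishes on xy + yx. *)
Lemma reflected_eq0_no_binomial :
  (forall i, (1 < i < n)%N -> 'C(n, i)%:R = 0 :> D) -> n <> 2%N ->
  forall x, f x = 0.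
Proof.
move=> C0 n2.
have C0' i : (0 < i < n)%N -> 'C(n, i)%:R = 0 :> D.
  case: (ltngtP i 1%N) => [|i1 /andP[_ iN]|-> n1]; first by case: i.
    by apply: C0; rewrite i1.
  by rewrite -bin_sub ?C0 //; lia.
have pd0 x : power_defect n x = 0.
  rewrite /power_defect exprD_of_bin0 //; last exact/commr_sym/commr1.
  by rewrite expr1n addrAC addrK subrr.
have gE x : g x = - f x by apply: reflected_opp; rewrite pd0 mul0r.
have fmul x z : x * z = z * x -> f (x * x * z) = x ^+ n * f z.
  move=> xz; rewrite (square_mul_identity divD n0 fg) // pd0 mul0r sub0r gE.
  by rewrite mulrN opprK.
(* at 1 + 1 the power map is additive: 2^n = 2, hence 4 f = 2 f *)
have fdouble x : f x + f x = 0.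
  have := fmul (1 + 1) x (central_nat 2 x).
  rewrite exprD_of_bin0 // expr1n !mulrDl !mul1r mulrDl mul1r raddfD raddfD
    -[X in _ = X]addr0.
  exact: addrI.
have fsq x : f (x * x) = x ^+ n * f 1.
  by rewrite -[X in f X]mulr1 fmul // mulr1 mul1r.
apply: (reflected_square_eq0 n0 fg) => // x y.
have polar : f (x * y + y * x) = ((x + y) ^+ n - x ^+ n - y ^+ n) * f 1.
  rewrite !mulrBl -!fsq mulrDl !mulrDr [y * x + _]addrC addrACA.
  by rewrite [f (_ + _ + _)]raddfD raddfD /= -addrA -opprD addrC addKr.
have [n1|n1] := eqVneq n 1%N.
  by rewrite polar n1 !expr1 -addrA -opprD subrr mul0r.
suff f1 : f 1 = 0 by rewrite polar f1 mulr0.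
have n3 : (2 < n)%N by lia.
have [finZ|infZ] := classic (finite_pred (@central D)).
  pose e : {additive D -> D} := f 1 \o* idfun.
  suff e0 : e 1 = 0 by move: e0; rewrite /e /= mul1r.
  apply: (@degree_ltX_eq0 _ divD finZ ncD n.-1).
  apply: (@eq_degree_lt _ _ (fun u => f (u * u))) => [u|].
    by rewrite fsq /e /= mulrA -exprSr prednK.
  by apply: degree_lt_leq (degree_lt_square f); rewrite prednK.
apply: NNPP => f1; apply: (not_all_central ncD).
apply: (all_central_of_pow divD infZ n0) => u v.
have -> : u ^+ n = (square_line u v ^+ n)`_0 by rewrite coef0X coef_square_line.
apply: (@square_line_identity _ divD infZ f n _ u v (f 1) 0) => //.
- by move=> z w cz; apply: fmul.
- exact: commrX.
move=> z cz; rewrite mul0r addr0 hornerX_central // horner_square_line.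
exact: fsq.
Qed.

Lemma reflected_eq0 : n <> 2%N -> forall x, f x = 0.
Proof.
move=> n2; have [[i [/andP[i1 iN] Ci]]|C0] :=
    classic (exists i, (1 < i < n)%N /\ 'C(n, i)%:R <> 0 :> D); last first.
  apply: reflected_eq0_no_binomial n2 => i iP; apply: NNPP => Ci.
  by apply: C0; exists i.
have [finZ|infZ] := classic (finite_pred (@central D)).
  exact: reflected_eq0_finite Ci finZ.
exact: reflected_eq0_infinite Ci infZ.
Qed.
End Reflected.
End Vanishing.

Theorem theorem1p5 (D : unitRingType) (divD : division_ring D)
    (ncD : noncommutative D) (n : nat) (f g : {additive D -> D})
    (fg : forall x : D, x \is a GRing.unit -> f x = x ^+ n * g x^-1) :
  (n = 2%N -> (forall x : D, f x = g x) /\ (forall x : D, f x = x * f 1)) /\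
  (n <> 2%N -> (forall x : D, f x = 0) /\ (forall x : D, g x = 0)).
Proof.
split=> [n2|n2]; last first.
  have gf := power_reflected_sym fg.
  case: (posnP n) => [n0|n0].
    rewrite n0 in fg gf.
    by split; [exact: power_reflected0 fg|exact: power_reflected0 gf].
  by split; [exact: (reflected_eq0 _ _ _ fg)|exact: (reflected_eq0 _ _ _ gf)].
rewrite {}n2 in fg.
have g1 := power_reflected1 fg.
pose e : {additive D -> D} := f 1 \o* idfun.
pose f' : {additive D -> D} := f \- e.
pose g' : {additive D -> D} := g \- e.
have fg' : power_reflected 2 f' g'.
  move=> x ux; rewrite /f' /g' /e /= mulrBr -fg //; congr (_ - _).
  by rewrite mulrA expr2 mulrK.
have f'0 x : f' x = 0.
  by apply: (reflected2_eq0 divD ncD fg'); rewrite /f' /e /= mul1r subrr.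
have g'0 x : g' x = 0.
  apply: (reflected2_eq0 divD ncD (power_reflected_sym fg')).
  by rewrite /g' /e /= mul1r -g1 subrr.
have fE x : f x = x * f 1 by apply/subr0_eq/f'0.
by split=> // x; rewrite fE; apply/esym/subr0_eq/g'0.
Qed.
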